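(* Let $A$ be the convolution matrix of the group $\mathbb{F}_2^n$ of order $v=2^n$. If $D\subseteq\mathbb{F}_2^n$ is a partial difference set with parameters $(v,k,\lambda,\mu)$, then there exists an eigenfunction $f$ of $A$ of the form $f=\chi_D+\beta\mathbf{1}+\alpha\chi_{\overline 0}$ for some $\alpha,\beta\in\mathbb{C}$.
   Context: $\overline 0$ is the zero vector; $\chi_D$ is the indicator function of $D$, $\chi_{\overline 0}$ the indicator function of $\{\overline 0\}$, and $\mathbf{1}$ the all-one function on $\mathbb{F}_2^n$. A subset $D$ of a finite abelian group $G$ with $0\notin D$ is a partial difference set with parameters $(v,k,\lambda,\mu)$ if $|G|=v$, $|D|=k$, for every $x\in D$ there are exactly $\lambda$ ordered pairs $(y_1,y_2)\in D\times D$ with $y_1-y_2=x$, and for every nonzero $x\in G\setminus D$ there are exactly $\mu$ ordered pairs $(y_1,y_2)\in D\times D$ with $y_1-y_2=x$. The convolution matrix $A=(a_{x,y,z})$ of $\mathbb{F}_2^n$ has $a_{x,y,z}=1$ if $x=y+z$ and $0$ otherwise ($x,y,z\in\mathbb{F}_2^n$). A function $f:\mathbb{F}_2^n\to\mathbb{C}$, $f\not\equiv0$, is an eigenfunction of $A$ if there is $\theta\in\mathbb{C}$ with $\sum_{y,z}a_{x,y,z}f(y)f(z)=\theta f(x)^2$ for all $x\in\mathbb{F}_2^n$. *)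

(* Defs.v *)
From HB Require Import structures.
From mathcomp Require Import all_boot all_order all_algebra.
From mathcomp Require Import reals complex.

Set Implicit Arguments.
Unset Strict Implicit.
Unset Printing Implicit Defensive.

Import GRing.Theory.
Local Open Scope ring_scope.

Definition partial_difference_set (G : finZmodType) (D : {set G})
    (v k lambda mu : nat) : Prop :=
  [/\ 0 \notin D,
      #|G| = v,
      #|D| = k,
      forall x, x \in D ->
        #|[set y in setX D D | y.1 - y.2 == x]| = lambda
    & forall x, x != 0 -> x \notin D ->
        #|[set y in setX D D | y.1 - y.2 == x]| = mu].

Definition indicator (C : pzRingType) (T : finType) (D : {set T}) : T -> C :=
  fun x => (x \in D)%:R.

(* A three-dimensional matrix over T is the function of its three indices. *)
Definition convolution_matrix (C : pzRingType) (G : finZmodType)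
    : G -> G -> G -> C :=
  fun x y z => (x == y + z)%:R.

(* The eigenvalue equation is quadratic on both sides: theta multiplies the
   pointwise square of f. *)
Definition eigenfunction (C : pzRingType) (T : finType)
    (A : T -> T -> T -> C) (f : T -> C) : Prop :=
  (exists x, f x != 0) /\
  exists theta : C, forall x,
    \sum_y \sum_z A x y z * f y * f z = theta * f x ^+ 2.

(* Main.v *)
Require Import Defs.
From HB Require Import structures.
From mathcomp Require Import all_boot all_order all_algebra.
From mathcomp Require Import reals complex.
From mathcomp Require Import ring.

(** For [f = chi_D + b + a chi_0] the convolution [f * f] is constant on each of
    [{0}], [D] and the rest [E] of the group, because [chi_D * chi_D] takes
    there the values [k], [lambda] and [mu] (in characteristic 2 sums and
    differences of elements agree).  So [f] is an eigenfunction for [t] as soon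
    as [(a, b, t)] solves three polynomial equations, one per class
    ([eigen_system]), and [f] is nonzero because its values on [D] and on [E]
    differ by [1].  If [D] or [E] is empty, the system does not prevent
    [f = 0], but then the constant [1] has the required form.

    The equations on [D] and [E] are linear in [(a, t)] with determinant
    proportional to [b (b + 1)].  Solving them and substituting in the equation
    at [0] leaves a polynomial in [b] whose coefficient of degree 8 is
    [4 v^2 (v - 1)], nonzero because [0] and the elements of [D] make [v > 1],
    and whose values at [0] and [-1] are
    [mu^3] and [w^3], where [w = v - 2 k + lambda].  If [mu] and [w] are
    nonzero, any root [b] avoids [0] and [-1] and yields a solution.  If
    [mu = 0], one can take [b = 0], and if [w = 0], [b = -1]: the equation on
    [E], respectively [D], then holds identically, and the other two reduce to
    a cubic equation for [a]. *)

Set Implicit Arguments.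
Unset Strict Implicit.
Unset Printing Implicit Defensive.

Import GRing.Theory.
Local Open Scope ring_scope.

(** * Polynomials *)

Lemma coef_mul_top (R : nzRingType) (p q : {poly R}) (m n : nat) :
  (size p <= m.+1)%N -> (size q <= n.+1)%N ->
  (p * q)`_(m + n) = p`_m * q`_n.
Proof.
move=> sp sq.
have lm : (m < (m + n).+1)%N by rewrite ltnS leq_addr.
rewrite coefM (bigD1 (Ordinal lm)) //= addKn big1 ?addr0 // => i.
rewrite -val_eqE /= neq_ltn => /orP[lti|lti].
  rewrite [q`__]nth_default ?mulr0 //; apply: leq_trans sq _.
  by rewrite ltn_subRL ltn_add2r.
by rewrite [p`__]nth_default ?mul0r //; apply: leq_trans sp _.
Qed.

Lemma size_mul_top (R : nzRingType) (p q : {poly R}) (m n : nat) :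
  (size p <= m.+1)%N -> (size q <= n.+1)%N -> (size (p * q)%R <= (m + n).+1)%N.
Proof.
move=> sp sq; apply: leq_trans (size_polyMleq _ _) _.
by rewrite -subn1 leq_subLR add1n -addnS -addSn leq_add.
Qed.

(** Exhibiting one nonzero nonconstant coefficient avoids computing the degree. *)
Lemma coef_neq0_root (C : closedFieldType) (p : {poly C}) (n : nat) :
  p`_n.+1 != 0 -> exists x, p.[x] = 0.
Proof.
move=> pn; have : size p != 1%N.
  by apply: contra pn => /eqP sp; rewrite nth_default // sp.
by move=> /closed_rootP[x /rootP px]; exists x.
Qed.

(** * The polynomial system *)

(** The equation [f * f = t f^2] at [0], on [D] and on the remaining elements,
    for [f = chi_D + b + a chi_0], when [chi_D * chi_D] takes there the values
    [k], [l] and [m], the set [D] has [k] elements and the group has order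
    [v]. *)
Definition eigen_system (C : pzRingType) (v k l m a b t : C) : Prop :=
  [/\ k + 2 * b * k + b ^+ 2 * v + 2 * a * b + a ^+ 2 = t * (b + a) ^+ 2,
      l + 2 * b * k + b ^+ 2 * v + 2 * a * b + 2 * a = t * (1 + b) ^+ 2
    & m + 2 * b * k + b ^+ 2 * v + 2 * a * b = t * b ^+ 2].

Section EigenSystem.

Variables (C : numClosedFieldType) (v k l m : C).

Let two_neq0 : (2 : C) != 0. Proof. by rewrite Num.Theory.pnatr_eq0. Qed.

(** With [b = 0] the last equation reads [m = 0]; the second one gives [t], and
    the first becomes a cubic in [a]. *)
Lemma eigen_system_b0 : m = 0 -> exists a b t, eigen_system v k l m a b t.
Proof.
move=> ->.
have [|a] := @coef_neq0_root C (Poly [:: - k; 0; l - 1; 2]) 2.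
  by rewrite coef_Poly.
rewrite horner_Poly /= => ea; exists a, 0, (l + 2 * a).
split; try ring.
apply/eqP; rewrite -subr_eq0 -oppr_eq0; apply/eqP; rewrite -[RHS]ea; ring.
Qed.

(** With [b = -1] the second equation is the hypothesis; the last one gives [t],
    and the first becomes a cubic in [a]. *)
Lemma eigen_system_bN1 :
  v - 2 * k + l = 0 -> exists a b t, eigen_system v k l m a b t.
Proof.
move=> w0; pose c := v + m - 2 * k.
have [|a] := @coef_neq0_root C
    (Poly [:: v - k - c; 2 * c; 1 - c - 2 * 2; 2]) 2.
  by rewrite coef_Poly.
rewrite horner_Poly /= => ea.
exists a, (-1), (c - 2 * a).
split; rewrite /c in ea *; last by ring.
  by apply/eqP; rewrite -subr_eq0; apply/eqP; rewrite -[RHS]ea; ring.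
by apply/eqP; rewrite -subr_eq0; apply/eqP; rewrite -[RHS]w0; ring.
Qed.

(** [N / (X (X + 1))] and [M / (2 X (X + 1))] are the values of [t] and [a]
    forced by the equations on [D] and on the remaining elements. *)
Let N : {poly C} := Poly [:: - m; l - m - 2 * k; - v].
Let M : {poly C} :=
  Poly [:: - m; - 2 * k - 2 * m; l - m - v - 2 * 2 * k; - 2 * v].

(** What remains of the equation at [0], cleared of denominators. *)
Let F : {poly C} :=
  M * (M * Poly [:: 0; 1; 1] - N * (M + Poly [:: 0; 0; 4; 4]))
    + Poly [:: 0; 0; 0; 1; 3; 3; 1] * (4 * (k - m))%:P.

Let coefF8 : F`_8 = 4 * v ^+ 2 * (v - 1).
Proof.
have sM : (size M <= 4)%N by exact: size_Poly.
have sM4 : (size (M + Poly [:: 0; 0; 4; 4])%R <= 4)%N.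
  by rewrite (leq_trans (size_polyD _ _)) // geq_max sM size_Poly.
have sN : (size N <= 3)%N by exact: size_Poly.
have sQ :
    (size (M * Poly [:: 0; 1; 1] - N * (M + Poly [:: 0; 0; 4; 4]))%R <= 6)%N.
  rewrite (leq_trans (size_polyD _ _)) // size_polyN geq_max.
  by rewrite (@size_mul_top _ _ _ 3 2) ?(@size_mul_top _ _ _ 2 3) ?size_Poly.
rewrite /F coefD coefMC coef_Poly /= mul0r addr0.
rewrite -[8%N]/(3 + 5)%N (coef_mul_top sM sQ) coefB.
rewrite -{1}[5%N]/(3 + 2)%N -[5%N]/(2 + 3)%N.
rewrite (coef_mul_top sN sM4) (coef_mul_top sM) ?size_Poly //.
rewrite coefD !coef_Poly /=; ring.
Qed.

(** [F] takes the values [m^3] at [0] and [(v - 2 k + l)^3] at [-1], so unless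
    one of the two special cases applies, its roots leave the denominators of
    [a] and [t] nonzero. *)
Lemma eigen_system_solvable :
  v != 0 -> v != 1 -> exists a b t, eigen_system v k l m a b t.
Proof.
move=> v0 v1.
have [m0|m0] := eqVneq m 0; first exact: eigen_system_b0.
have [w0|w0] := eqVneq (v - 2 * k + l) 0; first exact: eigen_system_bN1.
have [|b] := @coef_neq0_root C F 7.
  by rewrite coefF8 !mulf_neq0 ?expf_neq0 ?subr_eq0 // Num.Theory.pnatr_eq0.
rewrite /F /M /N !(hornerD, hornerN, hornerM, hornerC) !horner_Poly /= => eb.
have b0 : b != 0.
  apply: contraNneq m0 => b0; rewrite b0 in eb.
  suff: m ^+ 3 == 0 by rewrite expf_eq0.
  by apply/eqP; rewrite -[RHS]eb; ring.
have b1 : b + 1 != 0.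
  apply: contraNneq w0 => /eqP; rewrite addr_eq0 => /eqP b1; rewrite b1 in eb.
  suff: (v - 2 * k + l) ^+ 3 == 0 by rewrite expf_eq0.
  by apply/eqP; rewrite -[RHS]eb; ring.
exists ((- 2 * v * b ^+ 3 + (l - m - v - 2 * 2 * k) * b ^+ 2
          - (2 * k + 2 * m) * b - m) / (2 * (b * (b + 1)))), b,
  ((- v * b ^+ 2 + (l - m - 2 * k) * b - m) / (b * (b + 1))).
split; last 2 first.
- by field; rewrite b0 b1.
- by field; rewrite b0 b1.
(* The two sides of the equation at 0 differ by F.[b] / (4 (b (b + 1))^3). *)
apply/eqP; rewrite -subr_eq0; apply/eqP.
rewrite -[RHS](mul0r (4 * (b * (b + 1)) ^+ 3)^-1) -eb.
by field; rewrite b0 b1.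
Qed.

End EigenSystem.

(** * Convolution of indicator functions *)

Section Convolution.

Variables (C : comNzRingType) (G : finZmodType).

Lemma sum_convolution_matrix (f : G -> C) (x : G) :
  \sum_y \sum_z convolution_matrix C x y z * f y * f z
    = \sum_y f y * f (x - y).
Proof.
apply: eq_bigr => y _; rewrite (bigD1 (x - y)) //= big1 ?addr0 => [|z zxy].
  by rewrite /convolution_matrix addrC subrK eqxx mul1r.
rewrite /convolution_matrix; case: eqP => [xyz|_]; last by rewrite !mul0r.
by rewrite xyz addrC addKr eqxx in zxy.
Qed.

Lemma const1_eigenfunction :
  eigenfunction (convolution_matrix C (G := G)) (fun=> 1).
Proof.
split; first by exists 0; rewrite oner_neq0.
exists #|G|%:R => x; rewrite sum_convolution_matrix.
rewrite (eq_bigr (fun=> 1)) => [|y _]; last by rewrite mulr1.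
by rewrite expr1n mulr1 sumr_const.
Qed.

Lemma sum_indicator (D : {set G}) : \sum_y indicator C D y = #|D|%:R.
Proof.
rewrite -sum1_card natr_sum [RHS]big_mkcond /=.
by apply: eq_bigr => y _; rewrite /indicator; case: (y \in D).
Qed.

Lemma sum_sub_perm (g : G -> C) (x : G) : \sum_y g (x - y) = \sum_y g y.
Proof. by rewrite [RHS](reindex_inj (inv_inj (subKr x))). Qed.

Lemma sum_indicator0l (g : G -> C) : \sum_y indicator C [set 0] y * g y = g 0.
Proof.
rewrite (bigD1 0) //= big1 ?addr0 => [|y /negPf y0].
  by rewrite /indicator set11 mul1r.
by rewrite /indicator inE y0 mul0r.
Qed.

Lemma sum_indicator0r (g : G -> C) (x : G) :
  \sum_y g y * indicator C [set 0] (x - y) = g x.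
Proof.
rewrite -[LHS](sum_sub_perm _ x).
under eq_bigr => y _ do rewrite subKr mulrC.
by rewrite sum_indicator0l subr0.
Qed.

Hypothesis opp_id : forall x : G, - x = x.

(** The convolution counts sums equal to [x], the partial difference set axioms
    count differences; the two agree because every element is its own
    opposite. *)
Lemma sum_indicator_sub (D : {set G}) (x : G) :
  \sum_y indicator C D y * indicator C D (x - y)
    = #|[set y in setX D D | y.1 - y.2 == x]|%:R.
Proof.
rewrite -sum1_card natr_sum [RHS]big_mkcond /=.
transitivity (\sum_y \sum_z
    (if (y, z) \in [set y in setX D D | y.1 - y.2 == x] then 1 else 0 : C));
  last by rewrite pair_bigA; apply: eq_bigr => -[].
apply: eq_bigr => y _; rewrite (bigD1 (x - y)) //= big1 ?addr0 => [|z zxy].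
  have yxy : y - (x - y) = x by rewrite [- (_ - _)]opp_id addrC subrK.
  rewrite !inE /= yxy eqxx andbT /indicator.
  by case: (y \in D); case: (x - y \in D); rewrite /= ?mulr0 ?mulr1 ?mul0r.
rewrite !inE /=; case: ifP => // /andP[_ /eqP yzx].
by rewrite -yzx addrAC subrr add0r opp_id eqxx in zxy.
Qed.

Lemma convolution_indicator_shift (D : {set G}) (a b : C) (x : G) :
  let f y := indicator C D y + b + a * indicator C [set 0] y in
  \sum_y f y * f (x - y) =
    #|[set y in setX D D | y.1 - y.2 == x]|%:R + 2 * b * #|D|%:R
      + b ^+ 2 * #|G|%:R + 2 * a * b + 2 * a * indicator C D x
      + a ^+ 2 * indicator C [set 0] x.
Proof.
set d := indicator C D; set e := indicator C [set 0]; rewrite /=.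
have sd : \sum_y d y = #|D|%:R by exact: sum_indicator.
have se : \sum_y e y = 1 by rewrite sum_indicator cards1.
rewrite (eq_bigr (fun y => d y * d (x - y) + b * d y + b * d (x - y)
    + a * (e y * d (x - y)) + a * (d y * e (x - y)) + b ^+ 2
    + a * b * e y + a * b * e (x - y) + a ^+ 2 * (e y * e (x - y))));
  last by move=> y _; ring.
rewrite !big_split /= -!mulr_sumr sum_indicator_sub.
rewrite (sum_sub_perm d) (sum_sub_perm e) sd se.
rewrite (sum_indicator0l (fun y => d (x - y))).
rewrite (sum_indicator0l (fun y => e (x - y))).
rewrite sum_indicator0r subr0 sumr_const -mulr_natr.
by rewrite -[#|xpredT|]/(#|G|); ring.
Qed.

End Convolution.

(** * Eigenfunctions from partial difference sets *)

(** The group enters only through its elements being their own opposites, and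
    the field only through being algebraically closed of characteristic 0. *)
Lemma eigenfunction_of_partial_difference_set (C : numClosedFieldType)
    (G : finZmodType) (D : {set G}) (v k lambda mu : nat) :
  (forall x : G, - x = x) -> partial_difference_set D v k lambda mu ->
  exists f : G -> C,
    eigenfunction (convolution_matrix C (G := G)) f /\
    exists alpha beta : C, forall x : G,
      f x = indicator C D x + beta * 1 + alpha * indicator C [set 0] x.
Proof.
move=> opp_id [D0 cardG cardD cardDD cardDE].
have [->|[x1 x1D]] := set_0Vmem D.
  exists (fun=> 1); split; first exact: const1_eigenfunction.
  by exists 0, 1 => x; rewrite /indicator in_set0 mul0r mulr1 addr0 add0r.
have [E0|[x2]] := set_0Vmem (~: (0 |: D)).
  exists (fun=> 1); split; first exact: const1_eigenfunction.
  exists 1, 0 => x; rewrite /indicator in_set1 mul0r addr0 mul1r.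
  have /setP/(_ x) := E0; rewrite !inE.
  case: eqP => [->|_ /= /negbFE ->]; last by rewrite addr0.
  by rewrite (negPf D0) add0r.
rewrite !inE negb_or => /andP[x20 x2D].
have x10 : x1 != 0 by apply: contraNneq D0 => <-.
have v_gt1 : (1 < v)%N.
  by rewrite -cardG; apply/card_gt1P; exists x1, 0; rewrite !inE.
have v0 : (v%:R : C) != 0 by rewrite Num.Theory.pnatr_eq0 -lt0n ltnW.
have v1 : (v%:R : C) != 1.
  by rewrite Num.Theory.pnatr_eq1 neq_ltn v_gt1 orbT.
have [a [b [t [eq0 eqD eqE]]]] :=
  eigen_system_solvable k%:R lambda%:R mu%:R v0 v1.
pose f y := indicator C D y + b + a * indicator C [set 0] y.
exists f; split; last by exists a, b => x; rewrite mulr1.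
have fx1 : f x1 = 1 + b.
  by rewrite /f /indicator x1D in_set1 (negPf x10) mulr0 addr0.
have fx2 : f x2 = b.
  by rewrite /f /indicator (negPf x2D) in_set1 (negPf x20) mulr0 addr0 add0r.
split.
  have [b0|b0] := eqVneq b 0; last by exists x2; rewrite fx2.
  by exists x1; rewrite fx1 b0 addr0 oner_neq0.
exists t => x; rewrite sum_convolution_matrix convolution_indicator_shift //.
rewrite cardG cardD /f /indicator in_set1.
have [->|x0] := eqVneq x 0.
  (* The pairs with difference 0 are the diagonal of D. *)
  rewrite (negPf D0) (_ : #|_| = k) /=.
    by rewrite mulr0 !mulr1 addr0 add0r eq0.
  rewrite -cardD -(card_imset _ (_ : injective (fun y : G => (y, y)))).
    apply: eq_card => -[y z]; rewrite !inE /= subr_eq0.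
    apply/andP/imsetP => [[/andP[yD _] /eqP <-]|[u uD [-> ->]]].
      by exists y.
    by rewrite uD eqxx.
  by move=> y z [].
have [xD|xD] := boolP (x \in D).
  by rewrite cardDD //= !mulr0 !addr0 mulr1 eqD.
by rewrite cardDE //= !mulr0 !addr0 add0r eqE.
Qed.

Theorem proposition7 (R : realType) (n : nat) (D : {set 'rV['F_2]_n})
    (k lambda mu : nat)
    (hD : partial_difference_set D (2 ^ n)%N k lambda mu) :
  exists f : 'rV['F_2]_n -> R[i],
    eigenfunction (convolution_matrix R[i] (G := 'rV['F_2]_n)) f /\
    exists alpha beta : R[i], forall x : 'rV['F_2]_n,
      f x = indicator R[i] D x + beta * 1 + alpha * indicator R[i] [set 0] x.
Proof.
apply: eigenfunction_of_partial_difference_set hD => x.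
by apply/matrixP=> i j; rewrite mxE; apply: oppr_pchar2; exact: pchar_Fp.
Qed.
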